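(* Let $\Delta=\Delta^{rk}$ be the merging operator defined with rank revision in the context. Satisfied postulates. For every finite set $\mathcal V$ of propositional variables, every profile $\Phi$ and all programs $P$ (and all nonempty programs $P_1,P_2$) over $\mathcal V$: - (FP0) $\Delta_P(\Phi)\vdash P$; - (FP1) if $P$ is consistent, then $\Delta_P(\Phi)$ is consistent; - (FP2) if $C_{fc}(\bigcup\Phi\cup P)$ is consistent, then $\Delta_P(\Phi)=C_{fc}(\bigcup\Phi\cup P)$; - (FP4) if $P_1\vdash P$, $P_2\vdash P$ and $P_1$ and $P_2$ are consistent, then $C_{fc}(\Delta_P(P_1,P_2)\cup P_1)\neq \mathit{Lit}$ implies $C_{fc}(\Delta_P(P_1,P_2)\cup P_2)\neq \mathit{Lit}$. Postulates not satisfied. Each of the following fails in general, i.e. for each of them there are a finite set $\mathcal V$, and profiles and programs over $\mathcal V$, violating it: - (FP3) if $\Phi_1=\{P_1,\dots,P_n\}$, $\Phi_2=\{Q_1,\dots,Q_n\}$, $C_{fc}(P_i)=C_{fc}(Q_i)$ for all $i$, and $C_{fc}(P)=C_{fc}(Q)$, then $\Delta_P(\Phi_1)=\Delta_Q(\Phi_2)$; - (FP5) $\Delta_P(\Phi_1)\cup\Delta_P(\Phi_2)\vdash\Delta_P(\Phi_1\sqcup\Phi_2)$; - (FP6) if $\Delta_P(\Phi_1)\cup\Delta_P(\Phi_2)$ is consistent, then $\Delta_P(\Phi_1\sqcup\Phi_2)\vdash\Delta_P(\Phi_1)\cup\Delta_P(\Phi_2)$; - (FP7) $\Delta_P(\Phi)\cup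 Q\vdash\Delta_{P\cup Q}(\Phi)$; - (FP8) if $\Delta_P(\Phi)\cup Q$ is consistent, then $\Delta_{P\cup Q}(\Phi)\vdash\Delta_P(\Phi)\cup Q$.
   Context: Programs. Let $\mathcal V$ be a finite set of propositional variables (atoms). A literal (or fact) is an atom or the negation of an atom; $\mathit{Lit}$ is the set of literals. An atom and its negation are called opposed. A rule is a formula $l_1,\dots,l_n\to l_{n+1}$ with all $l_i$ literals; $\{l_1,\dots,l_n\}$ is its body and $l_{n+1}$ its head; a fact $l$ is regarded as a rule $\to l$ with empty body. A program is a set $R\cup L$ with $R$ a finite set of rules with nonempty body and $L$ a finite set of facts. In particular a set of literals is a program. Consequences. For a program $P=R\cup L$, $C_{fc}(P)$ is the smallest set of literals $L'$ (for inclusion) such that (i) $L\subseteq L'$; (ii) if $l_1,\dots,l_n\to l$ is in $R$ and $l_1,\dots,l_n\in L'$ then $l\in L'$; (iii) if $L'$ contains two opposed literals then $L'=\mathit{Lit}$. $P$ is consistent if $C_{fc}(P)$ does not contain two opposed literals, and inconsistent otherwise. A program (or set of literals) $Q$ is $P$-consistent if $Q\cup P$ is consistent. Entailment: $P\vdash Q$ means $C_{fc}(Q)\subseteq C_{fc}(P)$. Base and rank. A rule of $P$ with body $L$ is exceptional for $P$ if $L\cup P$ is inconsistent. Put $P_0=P$ and let $P_{i+1}$ be the set of exceptional rules of $P_i$. Let $n_0$ be the first integer such that $P_m=P_{n_0}$ for all $m>n_0$. The base of $P$ is $\langle P_0,\dots,P_{n_0}\rangle$ if $P_{n_0}=\emptyset$,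 and $\langle P_0,\dots,P_{n_0},\emptyset\rangle$ otherwise. Write the base as $\langle P_0,\dots,P_n\rangle$ (so $P_n=\emptyset$). The rank is $\rho(P,Q)=\min\{i: Q \text{ is } P_i\text{-consistent}\}$ if $P$ and $Q$ are both consistent, and $\rho(P,Q)=n$ otherwise; here $P_i$ denotes the $i$-th entry of the base. Rank revision: $P\circ_{rk}P'=P_{\rho(P,P')}\cup P'$, where $P_{\rho(P,P')}$ is the corresponding entry of the base of $P$. Merging. A profile is a finite nonempty multiset $\Phi=\{P_1,\dots,P_n\}$ of nonempty programs; $\bigcup\Phi$ is the union of its programs, and $\sqcup$ is multiset union. For a profile $\{P_1,\dots,P_n\}$ and a program $P$ (the integrity constraint), $\Delta^{rk}_P(P_1,\dots,P_n)$, also written $\Delta^{rk}_P(\Phi)$, is the set of literals equal to $C_{fc}(P\cup P_1\cup\dots\cup P_n)$ if this is consistent, and to $\bigcap_{i=1}^n C_{fc}(P_i\circ_{rk}P)$ otherwise. *)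

(* Defs.v *)
From mathcomp Require Export all_boot.
From mathcomp Require Import boolp.
From mathcomp Require Export finmap multiset.

Set Implicit Arguments.
Unset Strict Implicit.
Unset Printing Implicit Defensive.

(* (v, true) is the atom v, (v, false) its negation. *)
Definition lit (V : finType) : finType := (V * bool)%type.
Definition neg (V : finType) (l : lit V) : lit V := (l.1, ~~ l.2).

(* A rule is a pair (body, head); a fact is a rule with empty body. *)
Definition rule (V : finType) : finType := ({set lit V} * lit V)%type.
Definition rule_body (V : finType) (r : rule V) : {set lit V} := r.1.
Definition rule_head (V : finType) (r : rule V) : lit V := r.2.

(* P is R :|: L with R its rules with nonempty body and L those with empty
   body. *)
Definition program (V : finType) : finType := {set rule V}.

Section Programs.
Variable V : finType.
Implicit Types (P Q : program V) (L X : {set lit V}).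

Definition facts L : program V := [set ((set0, l) : rule V) | l in L].

Definition has_opposed X : bool := [exists l in X, neg l \in X].

(* The first conjunct covers both L \subset X (rules with empty body) and
   closure of X under the rules with nonempty body. *)
Definition fc_closed P X : bool :=
  [forall r in P, (rule_body r \subset X) ==> (rule_head r \in X)]
  && (has_opposed X ==> (X == [set: lit V])).

Definition Cfc P : {set lit V} := \bigcap_(X : {set lit V} | fc_closed P X) X.

Lemma Cfc_min P X : fc_closed P X -> Cfc P \subset X.
Proof. exact: bigcap_inf. Qed.

Lemma Cfc_closed P : fc_closed P (Cfc P).
Proof.
apply/andP; split.
  apply/forall_inP => r rP; apply/implyP => /subsetP sb.
  apply/bigcapP => X clX; have /andP[/forall_inP/(_ _ rP)/implyP h _] := clX.
  apply: h; apply/subsetP => l /sb; exact: (subsetP (Cfc_min clX)).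
apply/implyP => /exists_inP[l lC nlC]; rewrite -subTset.
apply/bigcapsP => X clX; have /andP[_ /implyP/(_ _)/eqP->] := clX => //.
by apply/exists_inP; exists l; apply: (subsetP (Cfc_min clX)).
Qed.

Definition consistent P : bool := ~~ has_opposed (Cfc P).

Definition consistent_with P Q : bool := consistent (Q :|: P).

Definition entails P Q : bool := Cfc Q \subset Cfc P.

Definition exceptional P (r : rule V) : bool :=
  ~~ consistent (facts (rule_body r) :|: P).

Definition stage P (i : nat) : program V :=
  iter i (fun Q => [set r in Q | exceptional Q r]) P.

Lemma stage_stationary P :
  exists n, `[< forall m, n < m -> stage P m = stage P n >].
Proof.
have sub i : stage P i.+1 \subset stage P i.
  by apply/subsetP => r; rewrite inE => /andP[].
have [n _ eqn] : exists2 n, n <= #|P| & stage P n.+1 = stage P n.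
  have {}sub k : (exists2 n, n < k & stage P n.+1 = stage P n)
      \/ k + #|stage P k| <= #|P|.
    elim: k => [|k [[n nk e]|IH]]; first by right.
      by left; exists n => //; apply: ltnW.
    have [e|ne] := eqVneq (stage P k.+1) (stage P k).
      by left; exists k.
    right; apply: leq_trans IH; rewrite addSnnS leq_add2l.
    by apply: proper_card; rewrite properEneq ne sub.
  have [[n nk e]|h] := sub #|P|.+1; first by exists n.
  by move: h; rewrite addSn ltnNge leq_addr.
exists n; apply/asboolP => m; elim: m => // m IH.
rewrite ltnS leq_eqVlt => /predU1P[<-//|/IH e].
by rewrite -[RHS]eqn /stage !iterS -!/(stage _ _) e.
Qed.

Definition stage_limit P : nat := ex_minn (stage_stationary P).

Definition base P : seq (program V) :=
  let s := [seq stage P i | i <- iota 0 (stage_limit P).+1] in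
  if stage P (stage_limit P) == set0 then s else rcons s set0.

Definition base_entry P (i : nat) : program V := nth set0 (base P) i.

(* [find] returns the least index; the last entry of the base being empty,
   such an index exists when Q is consistent. *)
Definition rank P Q : nat :=
  if consistent P && consistent Q
  then find (fun Pi => consistent_with Pi Q) (base P)
  else (size (base P)).-1.

Definition rank_revision P Q : program V := base_entry P (rank P Q) :|: Q.

Implicit Type Phi : {mset program V}%mset.

Definition profile Phi : Prop :=
  Phi <> mset0 /\ (forall P, P \in Phi -> P <> set0).

Definition profile_union Phi : program V := \bigcup_(P <- Phi) P.

Definition merge_rk P Phi : {set lit V} :=
  let C := Cfc (P :|: profile_union Phi) in
  if consistent (facts C) then C
  else \bigcap_(Pi <- Phi) Cfc (rank_revision Pi P).

End Programs.

(* Main.v *)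
Require Import Defs.

Set Implicit Arguments.
Unset Strict Implicit.
Unset Printing Implicit Defensive.

(* For consistent [P], every rank revision by [P] is consistent, because the
   last entry of a base is empty.  For FP4, the entries of the base of [P2] of
   positive index hold only exceptional rules of [P2], whose bodies are not
   included in [Cfc P2].  If [P2] entails [P], none of these rules can then fire
   on [Cfc P], so that revising [P2] at positive rank yields exactly [Cfc P],
   which is included in [Cfc P2]; at rank zero the revision extends [P2].
   Either way the merging result is consistent with [P2] as soon as the union
   of the profile with [P] is not consistent.
   The counterexamples exploit that merging forgets rules, be it because only
   literals are returned (FP3, FP5, FP7) or because of the intersection (FP6) or
   the rank (FP8) used under inconsistency. *)

(** * Forward-chaining consequences and consistency *)

Section Consequences.
Variable V : finType.
Implicit Types (P Q : program V) (L X Y B : {set lit V}) (l : lit V).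

Lemma Cfc_step P B l : (B, l) \in P -> B \subset Cfc P -> l \in Cfc P.
Proof.
by move=> rP sB; have /andP[/forall_inP/(_ _ rP)/implyP/(_ sB)] := Cfc_closed P.
Qed.

(** In the absence of opposed literals the explosion clause is void, so closure under the rules
    suffices. *)
Lemma Cfc_sub P X :
  (forall B l, (B, l) \in P -> B \subset X -> l \in X) -> ~~ has_opposed X ->
  Cfc P \subset X.
Proof.
move=> clX noX; apply: Cfc_min; rewrite /fc_closed (negPf noX) andbT.
by apply/forall_inP => -[B l] rP; apply/implyP => /clX ->.
Qed.

Lemma mem_facts L B l : ((B, l) \in facts L) = (B == set0) && (l \in L).
Proof.
apply/imsetP/andP => [[k kL [-> ->]]|[/eqP-> lL]]; first by rewrite eqxx.
by exists l.
Qed.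

Lemma facts_sub_Cfc P L : facts L \subset P -> L \subset Cfc P.
Proof.
move=> /subsetP sLP; apply/subsetP => l lL.
by apply: (@Cfc_step _ set0); rewrite ?sub0set// sLP// mem_facts eqxx.
Qed.

Lemma CfcS P Q : P \subset Q -> Cfc P \subset Cfc Q.
Proof.
move=> /subsetP sPQ; apply: Cfc_min; have /andP[/forall_inP cl op] := Cfc_closed Q.
by rewrite /fc_closed op andbT; apply/forall_inP => r /sPQ/cl.
Qed.

(** A form of cut: [Cfc Q] itself meets the closure conditions of [facts L :|: P]. *)
Lemma Cfc_factsU_sub L P Q :
  L \subset Cfc Q -> P \subset Q -> Cfc (facts L :|: P) \subset Cfc Q.
Proof.
move=> /subsetP sLQ /subsetP sPQ; apply: Cfc_min.
have /andP[/forall_inP cl op] := Cfc_closed Q; rewrite /fc_closed op andbT.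
apply/forall_inP => -[B l]; rewrite inE mem_facts => /orP[/andP[_ /sLQ lQ]|/sPQ/cl//].
by rewrite /rule_head lQ implybT.
Qed.

Lemma Cfc_facts_Cfc P : Cfc (facts (Cfc P)) = Cfc P.
Proof.
apply/eqP; rewrite eqEsubset (facts_sub_Cfc (subxx _)) andbT.
by rewrite -[facts _]setU0 Cfc_factsU_sub ?sub0set.
Qed.

Lemma has_opposedS X Y : X \subset Y -> has_opposed X -> has_opposed Y.
Proof.
move=> /subsetP sXY /exists_inP[l lX nlX].
by apply/exists_inP; exists l; apply: sXY.
Qed.

Lemma consistentS P Q : Cfc P \subset Cfc Q -> consistent Q -> consistent P.
Proof. by move=> sPQ; apply: contra; apply: has_opposedS. Qed.

(** Turns the test of [merge_rk], made on a set of literals, into a test on the program generating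
    them. *)
Lemma consistent_facts_Cfc P : consistent (facts (Cfc P)) = consistent P.
Proof. by rewrite /consistent Cfc_facts_Cfc. Qed.

Lemma consistent_sub P X : Cfc P \subset X -> ~~ has_opposed X -> consistent P.
Proof. by move=> sPX; apply: contra; apply: has_opposedS. Qed.

Lemma Cfc_facts L : ~~ has_opposed L -> Cfc (facts L) = L.
Proof.
move=> noL; apply/eqP; rewrite eqEsubset facts_sub_Cfc// andbT.
by apply: Cfc_sub => // B l; rewrite mem_facts => /andP[].
Qed.

Lemma consistent_facts L : ~~ has_opposed L -> consistent (facts L).
Proof. by move=> noL; rewrite /consistent Cfc_facts. Qed.

Lemma has_opposed0 : has_opposed (set0 : {set lit V}) = false.
Proof. by apply/exists_inP => -[l]; rewrite inE. Qed.

Lemma has_opposed1 l : has_opposed [set l] = false.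
Proof.
apply/exists_inP => -[k /set1P->]; case: l => v b.
by rewrite inE /neg xpair_eqE eqxx; case: b.
Qed.

Lemma Cfc_eq0 P : (forall l, (set0, l) \notin P) -> Cfc P = set0.
Proof.
move=> nfP; apply/eqP; rewrite -subset0; apply: Cfc_sub; last by rewrite has_opposed0.
by move=> B l rP; rewrite subset0 => /eqP B0; rewrite B0 (negPf (nfP l)) in rP.
Qed.

(** A rule of [P] has a head, so some literal exists. Over no atoms [Lit] is empty and would equal
    the consequences of a consistent program. *)
Lemma consistent_neqT P Q :
  P <> set0 -> consistent Q -> Cfc Q <> [set: lit V].
Proof.
move=> /eqP/set0Pn[r _] /negP cQ QT; apply: cQ; rewrite QT.
by apply/exists_inP; exists r.2; rewrite inE.
Qed.

(** Adding to [P] a body that it already derives yields no new consequence. *)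
Lemma exceptional_body P B l :
  consistent P -> B \subset Cfc P -> ~~ exceptional P (B, l).
Proof.
move=> cP sB; rewrite negbK; apply: consistentS cP; exact: Cfc_factsU_sub.
Qed.

End Consequences.

(** * Bases, ranks and revision of one program *)

Section RankRevision.
Variable V : finType.
Implicit Types (P Q : program V).

Lemma stage_sub P i : stage P i \subset P.
Proof.
elim: i => // i; apply: subset_trans; rewrite /stage iterS.
by apply/subsetP => r; rewrite inE => /andP[].
Qed.

(** Such a rule is exceptional for stage [i], a part of [P], and inconsistency persists when rules
    are added. *)
Lemma stage_exceptional P i r : r \in stage P i.+1 -> exceptional P r.
Proof.
rewrite /stage iterS -/(stage P i) inE => /andP[_]; apply: contra.
by apply: consistentS; rewrite CfcS// setUS// stage_sub.
Qed.

Lemma last_base P : nth set0 (base P) (size (base P)).-1 = set0.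
Proof.
rewrite nth_last /base; case: eqP => [e|_]; last by rewrite last_rcons.
by rewrite -addn1 iotaD map_cat last_cat /= e.
Qed.

Lemma base_entry0 P : base_entry P 0 = P.
Proof. by rewrite /base_entry /base; case: ifP. Qed.

(** The second case covers both the empty set appended to the base and the default value of [nth]
    beyond its end. *)
Lemma base_entryP P i : base_entry P i = stage P i \/ base_entry P i = set0.
Proof.
rewrite /base_entry /base; set n := (stage_limit P).+1.
have [lt_in|le_ni] := ltnP i n.
  left; case: ifP => _; rewrite ?nth_rcons ?size_map ?size_iota ?lt_in;
    by rewrite (nth_map 0) ?size_iota// nth_iota.
right; case: ifP => _; rewrite ?nth_rcons nth_default ?size_map ?size_iota//.
by rewrite ltnNge le_ni /=; case: ifP.
Qed.

Lemma base_entry_sub P i : base_entry P i \subset P.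
Proof. by case: (base_entryP P i) => ->; rewrite ?sub0set ?stage_sub. Qed.

Lemma base_entry_exceptional P i r :
  0 < i -> r \in base_entry P i -> exceptional P r.
Proof.
case: i => // i _; case: (base_entryP P i.+1) => ->; last by rewrite inE.
exact: stage_exceptional.
Qed.

Lemma rank_revision_sub P Q : rank_revision P Q \subset P :|: Q.
Proof. by rewrite setSU ?base_entry_sub. Qed.

(** If [P] is inconsistent, the rank selects the empty last entry and the revision is [Q]. Otherwise
    the search succeeds, at the latest on that entry. *)
Lemma consistent_rank_revision P Q :
  consistent Q -> consistent (rank_revision P Q).
Proof.
move=> cQ; rewrite /rank_revision /rank cQ andbT /base_entry.
have last_ok : consistent_with (nth set0 (base P) (size (base P)).-1) Q.
  by rewrite last_base /consistent_with setU0.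
case: ifP => _; last by rewrite setUC.
have /(nth_find set0) : has (fun Pi => consistent_with Pi Q) (base P).
  apply/(has_nthP set0); exists (size (base P)).-1 => //.
  (* The base has at least one entry, so the predecessor of its size is a valid index. *)
  by rewrite prednK// /base; case: ifP.
by rewrite /consistent_with setUC.
Qed.

Lemma Cfc_rank_revision P Q :
  consistent P -> Cfc Q \subset Cfc P -> 0 < rank P Q ->
  Cfc (rank_revision P Q) = Cfc Q.
Proof.
move=> cP sQP rk_gt0; apply/eqP; rewrite eqEsubset (CfcS (subsetUr _ _)) andbT.
apply: Cfc_sub; last exact: (consistentS sQP cP).
move=> B l /setUP[rP sB|]; last exact: Cfc_step.
(* A retained rule is exceptional, whereas its body would lie in [Cfc P]: [Cfc Q] is vacuously
   closed under it. *)
have := base_entry_exceptional rk_gt0 rP.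
by rewrite (negPf (exceptional_body _ cP (subset_trans sB sQP))).
Qed.

(** At rank zero the revision contains [P], so adding [P] again derives nothing new. At positive
    rank it has the consequences of [Q], which [P] already derives. *)
Lemma consistent_Cfc_rank_revisionU P Q :
  consistent P -> consistent Q -> Cfc Q \subset Cfc P ->
  consistent (facts (Cfc (rank_revision P Q)) :|: P).
Proof.
move=> cP cQ sQP; have [rk0|rk_gt0] := posnP (rank P Q).
  apply: consistentS (consistent_rank_revision P cQ); apply: Cfc_factsU_sub => //.
  by rewrite /rank_revision rk0 base_entry0 subsetUl.
by rewrite Cfc_rank_revision//; apply: consistentS cP; apply: Cfc_factsU_sub.
Qed.

End RankRevision.

(** * The merging operator and the satisfied postulates *)

Section Merging.
Variable V : finType.
Implicit Types (P Q : program V) (Phi : {mset program V}%mset).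

Lemma profile_unionD Phi1 Phi2 :
  profile_union (Phi1 `+` Phi2)%mset = profile_union Phi1 :|: profile_union Phi2.
Proof.
rewrite /profile_union !bigcup_seq; apply/setP => r; rewrite inE.
apply/bigcupP/orP => [[P]|[]/bigcupP[P PPhi rP]]; last 2 first.
- by exists P; rewrite // in_msetD PPhi.
- by exists P; rewrite // in_msetD PPhi orbT.
by rewrite in_msetD => /orP[] PPhi rP; [left|right]; apply/bigcupP; exists P.
Qed.

Lemma profile_union1 P : profile_union [mset P]%mset = P.
Proof. by rewrite /profile_union enum_msetn big_seq1. Qed.

Lemma merge_consistent P Phi :
  consistent (P :|: profile_union Phi) ->
  merge_rk P Phi = Cfc (P :|: profile_union Phi).
Proof. by rewrite /merge_rk consistent_facts_Cfc => ->. Qed.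

Lemma merge_inconsistent P Phi :
  ~~ consistent (P :|: profile_union Phi) ->
  merge_rk P Phi = \bigcap_(Pi in Phi) Cfc (rank_revision Pi P).
Proof.
by rewrite /merge_rk consistent_facts_Cfc => /negPf ->; rewrite bigcap_seq.
Qed.

Lemma merge1 P Q :
  consistent (P :|: Q) -> merge_rk P [mset Q]%mset = Cfc (P :|: Q).
Proof. by move=> cPQ; rewrite merge_consistent profile_union1. Qed.

Lemma Cfc_sub_merge P Phi : Cfc P \subset merge_rk P Phi.
Proof.
have [c|nc] := boolP (consistent (P :|: profile_union Phi)).
  by rewrite merge_consistent// CfcS// subsetUl.
by rewrite merge_inconsistent//; apply/bigcapsP => Q _; rewrite CfcS// subsetUr.
Qed.

Lemma merge_sub_rank_revision P Q Phi :
  ~~ consistent (P :|: profile_union Phi) -> Q \in Phi ->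
  merge_rk P Phi \subset Cfc (rank_revision Q P).
Proof. by move=> /merge_inconsistent-> QPhi; apply: bigcap_inf. Qed.

Lemma merge_nopposed P Phi :
  profile Phi -> consistent P -> ~~ has_opposed (merge_rk P Phi).
Proof.
move=> [Phi_n0 _] cP; have [c|nc] := boolP (consistent (P :|: profile_union Phi)).
  by rewrite merge_consistent.
(* A member of the profile is needed as an upper bound: an intersection over no program would be
   [Lit]. *)
have /hasP[Q QPhi _] : has predT Phi.
  apply/negP => /negP; rewrite -all_predC => /allP noPhi; apply: Phi_n0.
  by apply/msetP => Q; rewrite mset0E; apply/mset_eq0P/negP => /noPhi.
apply: contra (has_opposedS (merge_sub_rank_revision nc QPhi)) _.
exact: consistent_rank_revision.
Qed.

Lemma merge_entails P Phi : entails (facts (merge_rk P Phi)) P.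
Proof. exact: subset_trans (Cfc_sub_merge P Phi) (facts_sub_Cfc _). Qed.

(** The core of FP4. If the union with [P] is consistent, it contains [P2] and derives the merging
    result. If not, the result lies within the consequences of the revision of [P2] by [P], which
    are consistent with [P2]. *)
Lemma merge_neqT P P2 Phi :
  P2 <> set0 -> P2 \in Phi ->
  entails P2 P -> consistent P2 ->
  Cfc (facts (merge_rk P Phi) :|: P2) <> [set: lit V].
Proof.
move=> P2_n0 Phi2 sPP2 c2; apply: (consistent_neqT P2_n0).
have [c|nc] := boolP (consistent (P :|: profile_union Phi)).
  rewrite merge_consistent//; apply: consistentS c; apply: Cfc_factsU_sub => //.
  by rewrite subsetU// /profile_union bigcup_seq (bigcup_max P2) ?orbT.
have := consistent_Cfc_rank_revisionU c2 (consistentS sPP2 c2) sPP2.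
apply: consistentS; apply: Cfc_factsU_sub; last exact: subsetUr.
apply: subset_trans (merge_sub_rank_revision nc Phi2) _.
by apply: facts_sub_Cfc; apply: subsetUl.
Qed.

End Merging.

(** * Programs made of facts and one rule, as used in the counterexamples *)

Section SingleRule.
Variable V : finType.
Implicit Types (B L : {set lit V}) (l : lit V).

Lemma facts0 : facts (set0 : {set lit V}) = set0.
Proof. by apply/setP => -[B l]; rewrite mem_facts !inE andbF. Qed.

Lemma Cfc_facts_rule_blocked L B l :
  ~~ (B \subset L) -> ~~ has_opposed L -> Cfc (facts L :|: [set (B, l)]) = L.
Proof.
move=> nBL noL; apply/eqP; rewrite eqEsubset facts_sub_Cfc ?subsetUl// andbT.
apply: Cfc_sub => // B' l'; rewrite inE mem_facts => /orP[/andP[]//|].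
by move=> /set1P[-> _] sBL; rewrite sBL in nBL.
Qed.

Lemma Cfc_facts_rule_fired L B l :
  B \subset L -> l \in Cfc (facts L :|: [set (B, l)]).
Proof.
move=> sBL; apply: (@Cfc_step _ _ B); first by rewrite !inE eqxx orbT.
by apply: subset_trans sBL (facts_sub_Cfc _); apply: subsetUl.
Qed.

(** Whether or not the rule fires, [l |: L] is closed. *)
Lemma consistent_facts_rule L B l :
  ~~ has_opposed (l |: L) -> consistent (facts L :|: [set (B, l)]).
Proof.
move=> no; apply: (consistent_sub _ no); apply: Cfc_sub => // B' l'.
rewrite inE mem_facts => /orP[/andP[_ l'L] _|/set1P[_ ->] _]; last exact: setU11.
exact: setU1r.
Qed.

Lemma Cfc_rule B l : B != set0 -> Cfc [set (B, l)] = set0.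
Proof.
move=> B0; apply: Cfc_eq0 => k; rewrite inE xpair_eqE eq_sym.
by rewrite (negPf B0).
Qed.

Lemma consistent_rule B l : B != set0 -> consistent [set (B, l)].
Proof. by move=> B0; rewrite /consistent Cfc_rule ?has_opposed0. Qed.

Lemma profile1 (P : program V) : P != set0 -> profile [mset P]%mset.
Proof.
move=> P0; split=> [/msetP/(_ P)|Q]; first by rewrite msetnxx mset0E.
by rewrite in_mset1 => /eqP ->; apply/eqP.
Qed.

Lemma set1_neq0 (T : finType) (x : T) : [set x] != set0.
Proof. by rewrite -card_gt0 cards1. Qed.

Lemma facts1_neq0 l : facts [set l] != set0.
Proof. by rewrite /facts imset_set1 set1_neq0. Qed.

Lemma not_entails_facts (P : program V) L l :
  l \in L -> l \notin Cfc P -> ~ entails P (facts L).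
Proof.
move=> lL /negP nlP /subsetP sLP; apply: nlP; apply: sLP.
exact: (subsetP (facts_sub_Cfc (subxx _))).
Qed.

End SingleRule.

(** * Counterexamples over two atoms: a is [true] and b is [false] in [bool] *)

Definition fact_a : lit bool := (true, true).
Definition fact_b : lit bool := (false, true).

Definition only_a : program bool := facts [set fact_a].
Definition rule_ab : program bool := [set ([set fact_a], fact_b)].
Definition rule_ba : program bool := [set ([set fact_b], fact_a)].
(** Consistent alone, since nothing fires, but inconsistent with the fact a. *)
Definition rule_a_na : program bool := [set ([set fact_a], neg fact_a)].

Lemma consistent_ab : ~~ has_opposed [set fact_b; fact_a].
Proof. by apply/exists_inP => -[l /set2P[]->]; rewrite !inE. Qed.

Lemma consistent_only_a_rule_ab : consistent (only_a :|: rule_ab).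
Proof. exact: consistent_facts_rule consistent_ab. Qed.

Lemma Cfc_only_a : Cfc only_a = [set fact_a].
Proof. by rewrite Cfc_facts// has_opposed1. Qed.

Lemma consistent_only_a : consistent only_a.
Proof. by rewrite consistent_facts// has_opposed1. Qed.

Lemma merge_only_a : merge_rk set0 [mset only_a]%mset = [set fact_a].
Proof. by rewrite merge1 set0U ?Cfc_only_a ?consistent_only_a. Qed.

Lemma merge_rule B (l : lit bool) :
  B != set0 -> merge_rk set0 [mset ([set (B, l)] : program bool)]%mset = set0.
Proof. by move=> B0; rewrite merge1 set0U ?Cfc_rule ?consistent_rule. Qed.

Lemma fact_b_notin_only_a : fact_b \notin Cfc only_a.
Proof. by rewrite Cfc_only_a inE. Qed.

(** The rules a -> b and b -> a alone derive nothing, but under the constraint a only the first one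
    fires. *)
Lemma fp3_fails :
  exists (V : finType) (n : nat) (Ps Qs : n.-tuple (program V)) (P Q : program V),
    [/\ profile (seq_mset Ps), profile (seq_mset Qs),
        forall i : 'I_n, Cfc (tnth Ps i) = Cfc (tnth Qs i),
        Cfc P = Cfc Q
      & merge_rk P (seq_mset Ps) <> merge_rk Q (seq_mset Qs)].
Proof.
have seq_mset1 (R : program bool) : seq_mset [tuple R] = [mset R]%mset.
  by apply/msetP => S; rewrite mset_seqE msetnE /= addn0 eq_sym; case: eqP.
exists bool, 1, [tuple rule_ab], [tuple rule_ba], only_a, only_a.
rewrite !seq_mset1; split=> // [||i|].
- exact/profile1/set1_neq0.
- exact/profile1/set1_neq0.
- by rewrite !(tnth_nth set0) ord1 /= !Cfc_rule ?set1_neq0.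
have Cba : Cfc (only_a :|: rule_ba) = [set fact_a].
  by rewrite Cfc_facts_rule_blocked ?has_opposed1// sub1set inE.
have cba : consistent (only_a :|: rule_ba) by rewrite /consistent Cba has_opposed1.
rewrite !merge1 ?consistent_only_a_rule_ab// Cba => /setP/(_ fact_b).
by rewrite Cfc_facts_rule_fired ?inE.
Qed.

(** Merging a -> b alone returns no literal and so loses the rule, which fires when merged jointly
    with a. *)
Lemma fp5_fails :
  exists (V : finType) (Phi1 Phi2 : {mset program V}%mset) (P : program V),
    [/\ profile Phi1, profile Phi2
      & ~ entails (facts (merge_rk P Phi1 :|: merge_rk P Phi2))
                  (facts (merge_rk P (Phi1 `+` Phi2)%mset))].
Proof.
exists bool, [mset only_a]%mset, [mset rule_ab]%mset, set0.
split; [exact/profile1/facts1_neq0|exact/profile1/set1_neq0|].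
rewrite merge_only_a merge_rule ?set1_neq0// setU0.
apply: not_entails_facts fact_b_notin_only_a.
have c := consistent_only_a_rule_ab.
rewrite merge_consistent profile_unionD !profile_union1 set0U//.
exact: Cfc_facts_rule_fired.
Qed.

(** Merged separately, a and a -> not a keep the literal a. Their union is inconsistent, and the
    rule revised by the empty program derives nothing, so the intersection is empty. *)
Lemma fp6_fails :
  exists (V : finType) (Phi1 Phi2 : {mset program V}%mset) (P : program V),
    [/\ profile Phi1, profile Phi2,
        consistent (facts (merge_rk P Phi1 :|: merge_rk P Phi2))
      & ~ entails (facts (merge_rk P (Phi1 `+` Phi2)%mset))
                  (facts (merge_rk P Phi1 :|: merge_rk P Phi2))].
Proof.
exists bool, [mset only_a]%mset, [mset rule_a_na]%mset, set0.
rewrite merge_only_a merge_rule ?set1_neq0// setU0.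
split; [exact/profile1/facts1_neq0|exact/profile1/set1_neq0
  |exact: consistent_only_a|].
have -> : merge_rk set0 ([mset only_a] `+` [mset rule_a_na])%mset = set0.
  apply/eqP; rewrite -subset0 -(Cfc_rule (neg fact_a) (set1_neq0 fact_a)).
  have /merge_sub_rank_revision sub : ~~ consistent
      (set0 :|: profile_union ([mset only_a] `+` [mset rule_a_na])%mset).
    rewrite set0U profile_unionD !profile_union1 negbK.
    apply/exists_inP; exists fact_a; last exact: Cfc_facts_rule_fired.
    by apply: (subsetP (facts_sub_Cfc (subsetUl _ _))); rewrite inE.
  apply: subset_trans (sub rule_a_na _) _; first by rewrite in_msetD !in_mset1 eqxx orbT.
  by apply: subset_trans (CfcS (rank_revision_sub _ _)) _; rewrite setU0.
rewrite facts0; apply: (@not_entails_facts _ _ _ fact_a); first by rewrite inE.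
by rewrite Cfc_eq0 => [|l]; rewrite inE.
Qed.

(** The rule a -> b fires when a is part of the constraint, but is already lost when a is added
    after merging. *)
Lemma fp7_fails :
  exists (V : finType) (Phi : {mset program V}%mset) (P Q : program V),
    profile Phi /\
    ~ entails (facts (merge_rk P Phi) :|: Q) (facts (merge_rk (P :|: Q) Phi)).
Proof.
exists bool, [mset rule_ab]%mset, set0, only_a; split; first exact/profile1/set1_neq0.
rewrite merge_rule ?set1_neq0// facts0 !set0U.
apply: not_entails_facts fact_b_notin_only_a.
by rewrite merge1 ?consistent_only_a_rule_ab// Cfc_facts_rule_fired.
Qed.

(** The program with a and b -> not a merges to a, which is consistent with the fact b. Under the
    constraint b it must be revised at positive rank, where the fact a is dropped for not being
    exceptional. *)
Lemma fp8_fails :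
  exists (V : finType) (Phi : {mset program V}%mset) (P Q : program V),
    [/\ profile Phi,
        consistent (facts (merge_rk P Phi) :|: Q)
      & ~ entails (facts (merge_rk (P :|: Q) Phi)) (facts (merge_rk P Phi) :|: Q)].
Proof.
pose P1 := only_a :|: [set ([set fact_b], neg fact_a)].
pose Q := facts [set fact_b].
have prP1 : profile [mset P1]%mset.
  apply: profile1; apply/set0Pn; exists (set0, fact_a).
  by rewrite !inE mem_facts eqxx inE.
have CP1 : Cfc P1 = [set fact_a].
  by rewrite Cfc_facts_rule_blocked ?has_opposed1// sub1set inE.
have cP1 : consistent P1 by rewrite /consistent CP1 has_opposed1.
have cQ : consistent Q by rewrite consistent_facts ?has_opposed1.
have Qb (R : program bool) : Q \subset R -> fact_b \in Cfc R.
  by move=> /facts_sub_Cfc/subsetP; apply; rewrite inE.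
have P1a (R : program bool) : P1 \subset R -> fact_a \in Cfc R.
  move=> sP1R; apply: (subsetP (facts_sub_Cfc (subset_trans (subsetUl _ _) sP1R))).
  by rewrite inE.
have incons (R : program bool) : P1 :|: Q \subset R -> ~~ consistent R.
  rewrite subUset => /andP[sP1R sQR]; rewrite negbK.
  apply/exists_inP; exists fact_a; first exact: P1a.
  apply: (@Cfc_step _ _ [set fact_b]); last by rewrite sub1set Qb.
  by rewrite (subsetP sP1R)// !inE eqxx orbT.
have mP1 : merge_rk set0 [mset P1]%mset = [set fact_a] by rewrite merge1 set0U.
exists bool, [mset P1]%mset, set0, Q; rewrite mP1 set0U; split.
- exact: prP1.
- apply: consistent_sub consistent_ab; apply: Cfc_sub consistent_ab => B l.
  by rewrite inE !mem_facts !inE => /orP[]/andP[_ ->] //; rewrite orbT.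
move=> /subsetP/(_ fact_a); rewrite (subsetP (facts_sub_Cfc (subsetUl _ _))) ?inE//.
move/(_ isT); apply/negP.
(* At rank zero the revision would contain [P1 :|: Q], which derives both a and its negation. *)
have rk_gt0 : 0 < rank P1 Q.
  rewrite lt0n; apply: contraL (consistent_rank_revision P1 cQ) => /eqP rk0.
  by apply: incons; rewrite /rank_revision rk0 base_entry0.
have nc : ~~ consistent (Q :|: profile_union [mset P1]%mset).
  by rewrite profile_union1 incons// setUC.
rewrite Cfc_facts ?merge_nopposed//.
(* This bound holds b from the constraint and the head of the only rule of [P1] that can survive. *)
apply: contraNN (_ : fact_a \notin [set fact_b; neg fact_a]); last by rewrite !inE.
apply: subsetP; apply: subset_trans (merge_sub_rank_revision nc _) _.
  by rewrite in_mset1.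
apply: Cfc_sub => [B l|]; last first.
  by apply/exists_inP => -[l /set2P[]->]; rewrite !inE.
rewrite inE => /orP[rP|]; last by rewrite mem_facts !inE => /andP[_ ->].
have /setUP[] := subsetP (base_entry_sub _ _) _ rP.
  (* A fact has an empty body, hence is never exceptional for the consistent [P1]. *)
  rewrite mem_facts => /andP[/eqP B0 _]; rewrite B0 in rP.
  have := base_entry_exceptional rk_gt0 rP.
  by rewrite (negPf (exceptional_body _ cP1 (sub0set _))).
by move=> /set1P[_ -> _]; rewrite !inE eqxx orbT.
Qed.

Theorem theorem2 :
  (forall V : finType,
    [/\ (* FP0 *)
        forall (Phi : {mset program V}%mset) (P : program V),
          profile Phi -> entails (facts (merge_rk P Phi)) P,
        (* FP1 *)
        forall (Phi : {mset program V}%mset) (P : program V),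
          profile Phi -> consistent P -> consistent (facts (merge_rk P Phi)),
        (* FP2 *)
        forall (Phi : {mset program V}%mset) (P : program V),
          profile Phi ->
          consistent (facts (Cfc (profile_union Phi :|: P))) ->
          merge_rk P Phi = Cfc (profile_union Phi :|: P)
      & (* FP4 *)
        forall P P1 P2 : program V,
          P1 <> set0 -> P2 <> set0 ->
          entails P1 P -> entails P2 P -> consistent P1 -> consistent P2 ->
          Cfc (facts (merge_rk P [mset P1; P2]%mset) :|: P1) <> [set: lit V] ->
          Cfc (facts (merge_rk P [mset P1; P2]%mset) :|: P2) <> [set: lit V]])
  /\ (* FP3 fails *)
  (exists (V : finType) (n : nat) (Ps Qs : n.-tuple (program V))
          (P Q : program V),
     [/\ profile (seq_mset Ps), profile (seq_mset Qs),
         forall i : 'I_n, Cfc (tnth Ps i) = Cfc (tnth Qs i),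
         Cfc P = Cfc Q
       & merge_rk P (seq_mset Ps) <> merge_rk Q (seq_mset Qs)])
  /\ (* FP5 fails *)
  (exists (V : finType) (Phi1 Phi2 : {mset program V}%mset) (P : program V),
     [/\ profile Phi1, profile Phi2
       & ~ entails (facts (merge_rk P Phi1 :|: merge_rk P Phi2))
                   (facts (merge_rk P (Phi1 `+` Phi2)%mset))])
  /\ (* FP6 fails *)
  (exists (V : finType) (Phi1 Phi2 : {mset program V}%mset) (P : program V),
     [/\ profile Phi1, profile Phi2,
         consistent (facts (merge_rk P Phi1 :|: merge_rk P Phi2))
       & ~ entails (facts (merge_rk P (Phi1 `+` Phi2)%mset))
                   (facts (merge_rk P Phi1 :|: merge_rk P Phi2))])
  /\ (* FP7 fails *)
  (exists (V : finType) (Phi : {mset program V}%mset) (P Q : program V),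
     profile Phi /\
     ~ entails (facts (merge_rk P Phi) :|: Q) (facts (merge_rk (P :|: Q) Phi)))
  /\ (* FP8 fails *)
  (exists (V : finType) (Phi : {mset program V}%mset) (P Q : program V),
     [/\ profile Phi,
         consistent (facts (merge_rk P Phi) :|: Q)
       & ~ entails (facts (merge_rk (P :|: Q) Phi)) (facts (merge_rk P Phi) :|: Q)]).
Proof.
split=> [V|]; last first.
  exact: (conj fp3_fails (conj fp5_fails (conj fp6_fails (conj fp7_fails fp8_fails)))).
split=> [Phi P _|Phi P prPhi cP|Phi P _|P P1 P2 _ P2_n0 _ ent2 _ c2 _].
- exact: merge_entails.
- exact/consistent_facts/merge_nopposed.
- by rewrite consistent_facts_Cfc setUC => /merge_consistent.
- by apply: merge_neqT => //; rewrite in_mset2 eqxx orbT.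
Qed.
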